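(* Let $(\mathbb{X},d)$ be a metric space, let $S(\mathbb{X})$ be the poset of all nonempty subsets of $\mathbb{X}$ ordered by inclusion, and let $\Omega$ be the flow on $S(\mathbb{X})$ given by $\Omega_\varepsilon(A)=A_\varepsilon$. Then the interleaving distance $d_{S(\mathbb{X})}$ on $S(\mathbb{X})$ induced by $\Omega$ coincides with the Hausdorff distance: for all $A,B\in S(\mathbb{X})$, $$d_{S(\mathbb{X})}(A,B)=d_H(A,B).$$
   Context: For $A\subseteq\mathbb{X}$ and $\varepsilon\ge0$, $A_\varepsilon=\bigcup_{a\in A}\{x\in\mathbb{X}\mid d(a,x)\le\varepsilon\}$. The Hausdorff distance is $d_H(A,B)=\inf\{\varepsilon\ge0\mid A\subseteq B_\varepsilon\text{ and }B\subseteq A_\varepsilon\}$ (with $\inf\emptyset=\infty$). A flow $\mathcal{T}=(\mathcal{T},u,\mu)$ on a category $\mathcal{C}$ consists of: a functor $\mathcal{T}:([0,\infty),\le)\to\mathrm{End}(\mathcal{C})$, $\varepsilon\mapsto\mathcal{T}_\varepsilon$ (with $\mathcal{T}_{(\varepsilon\le\zeta)}:\mathcal{T}_\varepsilon\Rightarrow\mathcal{T}_\zeta$ the natural transformation assigned to $\varepsilon\le\zeta$); a natural transformation $u:I_{\mathcal{C}}\Rightarrow\mathcal{T}_0$; and natural transformations $\mu_{\varepsilon,\zeta}:\mathcal{T}_\varepsilon\mathcal{T}_\zeta\Rightarrow\mathcal{T}_{\varepsilon+\zeta}$ for all $\varepsilon,\zeta\ge0$; such that for all $\varepsilon,\zeta,\delta,\kappa\ge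 0$: (i) $\mu_{0,\varepsilon}\circ(u\,\mathcal{T}_\varepsilon)=\mathrm{id}_{\mathcal{T}_\varepsilon}$ and $\mu_{\varepsilon,0}\circ(\mathcal{T}_\varepsilon u)=\mathrm{id}_{\mathcal{T}_\varepsilon}$; (ii) $\mu_{\varepsilon,\zeta+\delta}\circ(\mathcal{T}_\varepsilon\mu_{\zeta,\delta})=\mu_{\varepsilon+\zeta,\delta}\circ(\mu_{\varepsilon,\zeta}\mathcal{T}_\delta)$; (iii) $\mu_{\delta,\kappa}\circ(\mathcal{T}_{(\varepsilon\le\delta)}\mathcal{T}_{(\zeta\le\kappa)})=\mathcal{T}_{(\varepsilon+\zeta\le\delta+\kappa)}\circ\mu_{\varepsilon,\zeta}$ whenever $\varepsilon\le\delta$ and $\zeta\le\kappa$. A weak $\varepsilon$-interleaving of objects $a,b$ of $\mathcal{C}$ is a pair of morphisms $\varphi:a\to\mathcal{T}_\varepsilon b$, $\psi:b\to\mathcal{T}_\varepsilon a$ such that $\mu_{\varepsilon,\varepsilon,a}\circ\mathcal{T}_\varepsilon\psi\circ\varphi=\mathcal{T}_{(0\le2\varepsilon),a}\circ u_a$ and $\mu_{\varepsilon,\varepsilon,b}\circ\mathcal{T}_\varepsilon\varphi\circ\psi=\mathcal{T}_{(0\le2\varepsilon),b}\circ u_b$. The interleaving distance between $a$ and $b$ induced by the flow is $\inf\{\varepsilon\ge0\mid \text{there is a weak }\varepsilon\text{-interleaving of }a,b\}$, with value $\infty$ if there is none for any $\varepsilon$. The poset $S(\mathbb{X})$ is viewed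 as a category. The flow $\Omega$ on it: $\Omega_\varepsilon(A)=A_\varepsilon$; $\Omega_\varepsilon$ sends $A\subseteq B$ to the inclusion $A_\varepsilon\subseteq B_\varepsilon$; $\Omega_{(\varepsilon\le\zeta)}$ is given by the inclusions $A_\varepsilon\subseteq A_\zeta$; $u$ by the inclusions $A\subseteq A_0$; and $\mu_{\varepsilon,\zeta}$ by the inclusions $(A_\zeta)_\varepsilon\subseteq A_{\varepsilon+\zeta}$. *)

(* Defs.v *)
From HB Require Import structures.
From mathcomp Require Import all_boot all_order all_algebra.
From mathcomp Require Import interval_inference.
From mathcomp Require Import boolp classical_sets reals constructive_ereal ereal.
From mathcomp Require Import topology.

Set Implicit Arguments.
Unset Strict Implicit.
Unset Printing Implicit Defensive.

Import Order.TTheory GRing.Theory Num.Theory.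

Local Open Scope classical_set_scope.
Local Open Scope ring_scope.

Declare Scope category_scope.
Delimit Scope category_scope with cat.
Local Open Scope category_scope.

Reserved Notation "g ∘ f" (at level 40, left associativity).

Record category : Type := Category {
  obj :> Type;
  hom : obj -> obj -> Type;
  idm : forall a, hom a a;
  compm : forall a b c, hom b c -> hom a b -> hom a c;
  compm1 : forall a b (f : hom a b), compm f (idm a) = f;
  comp1m : forall a b (f : hom a b), compm (idm b) f = f;
  compmA : forall a b c d (h : hom c d) (g : hom b c) (f : hom a b),
    compm h (compm g f) = compm (compm h g) f }.

Arguments idm {c} a : rename.
Notation "g ∘ f" := (compm g f) : category_scope.

Record functor (C D : category) : Type := Functor {
  fobj :> C -> D;
  fmap : forall a b, hom a b -> hom (fobj a) (fobj b);
  fmap1 : forall a, fmap (idm a) = idm (fobj a);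
  fmapM : forall a b c (g : hom b c) (f : hom a b),
    fmap (g ∘ f) = fmap g ∘ fmap f }.

Arguments fmap {C D} f {a b} _ : rename.

Program Definition id_functor (C : category) : functor C C :=
  @Functor C C id (fun _ _ f => f) _ _.
Next Obligation. by []. Qed.
Next Obligation. by []. Qed.

Program Definition comp_functor (C D E : category)
    (G : functor D E) (F : functor C D) : functor C E :=
  @Functor C E (fun a => G (F a)) (fun _ _ f => fmap G (fmap F f)) _ _.
Next Obligation. by move=> * /=; rewrite !fmap1. Qed.
Next Obligation. by move=> * /=; rewrite !fmapM. Qed.

Record nat_trans (C D : category) (F G : functor C D) : Type := NatTrans {
  component :> forall a, hom (F a) (G a);
  naturality : forall a b (f : hom a b),
    component b ∘ fmap F f = fmap G f ∘ component a }.

Lemma nat_transP (C D : category) (F G : functor C D) (s t : nat_trans F G) :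
  (forall a, s a = t a) -> s = t.
Proof.
case: s t => [s sP] [t tP] /= st.
have {}st : s = t by apply: functional_extensionality_dep.
by subst t; congr NatTrans; exact: Prop_irrelevance.
Qed.

Program Definition id_nat (C D : category) (F : functor C D) : nat_trans F F :=
  @NatTrans C D F F (fun a => idm (F a)) _.
Next Obligation. by move=> * /=; rewrite comp1m compm1. Qed.

Program Definition comp_nat (C D : category) (F G H : functor C D)
    (t : nat_trans G H) (s : nat_trans F G) : nat_trans F H :=
  @NatTrans C D F H (fun a => t a ∘ s a) _.
Next Obligation.
by move=> C D F G H t s a b f; rewrite -compmA naturality !compmA naturality.
Qed.

Program Definition functor_cat (C D : category) : category :=
  @Category (functor C D) (@nat_trans C D) (@id_nat C D) (@comp_nat C D) _ _ _.
Next Obligation. by move=> *; apply: nat_transP => x /=; rewrite compm1. Qed.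
Next Obligation. by move=> *; apply: nat_transP => x /=; rewrite comp1m. Qed.
Next Obligation. by move=> *; apply: nat_transP => x /=; rewrite compmA. Qed.

Definition End_cat (C : category) : category := functor_cat C C.

Section preorder_cat.
Variables (T : Type) (le : T -> T -> Prop).
Hypotheses (le_refl : forall x, le x x)
  (le_trans : forall x y z, le x y -> le y z -> le x z).

Program Definition preorder_cat : category :=
  @Category T le le_refl (fun x y z yz xy => le_trans xy yz) _ _ _.
Next Obligation. by move=> *; exact: Prop_irrelevance. Qed.
Next Obligation. by move=> *; exact: Prop_irrelevance. Qed.
Next Obligation. by move=> *; exact: Prop_irrelevance. Qed.

End preorder_cat.

Section nonneg.
Variable R : realType.
Implicit Types x y z : {nonneg R}.

Definition nng0 : {nonneg R} := 0%:nng.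
Definition nngD x y : {nonneg R} := (x%:num + y%:num)%:nng.
Definition nng_le x y : Prop := x%:num <= y%:num.

Lemma nng_le_refl x : nng_le x x. Proof. exact: lexx. Qed.

Lemma nng_le_trans x y z : nng_le x y -> nng_le y z -> nng_le x z.
Proof. exact: le_trans. Qed.

Lemma nng_ge0 x : nng_le nng0 x. Proof. by rewrite /nng_le /=. Qed.

Lemma nng_leD x y z t : nng_le x z -> nng_le y t -> nng_le (nngD x y) (nngD z t).
Proof. by rewrite /nng_le /= => ? ?; exact: lerD. Qed.

Lemma nngD0l x : nngD nng0 x = x.
Proof. by apply/val_inj; rewrite /= add0r. Qed.

Lemma nngD0r x : nngD x nng0 = x.
Proof. by apply/val_inj; rewrite /= addr0. Qed.

Lemma nngDA x y z : nngD x (nngD y z) = nngD (nngD x y) z.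
Proof. by apply/val_inj; rewrite /= addrA. Qed.

Definition nonneg_cat : category := preorder_cat nng_le_refl nng_le_trans.

End nonneg.

Arguments nng0 {R}.

(* The equalities 0 + e = e, e + 0 = e and e + (z + d) = (e + z) + d are only
   propositional, so the flow axioms that rely on them insert [reindex], the
   identity morphism transported along an equality of indices. *)
Definition reindex (R : realType) (C : category)
    (T : functor (nonneg_cat R) (End_cat C)) (a : C)
    (x y : {nonneg R}) (xy : x = y) : hom (T x a) (T y a) :=
  match xy in _ = z return hom (T x a) (T z a) with
  | erefl => idm (T x a)
  end.

(* Equalities of natural transformations are stated componentwise. In
   [flow_le_mult], the left-hand side is the component at [a] of
   [mu d k] after the horizontal composite of [T (e <= d)] and [T (z <= k)]. *)
Record flow (R : realType) (C : category) : Type := Flow {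
  flow_functor :> functor (nonneg_cat R) (End_cat C);
  flow_unit : nat_trans (id_functor C) (flow_functor nng0);
  flow_mult : forall e z : {nonneg R},
    nat_trans (comp_functor (flow_functor e) (flow_functor z))
              (flow_functor (nngD e z));
  flow_unitl : forall (e : {nonneg R}) (a : C),
    reindex flow_functor a (nngD0l e) ∘
      (flow_mult nng0 e a ∘ flow_unit (flow_functor e a))
    = idm (flow_functor e a);
  flow_unitr : forall (e : {nonneg R}) (a : C),
    reindex flow_functor a (nngD0r e) ∘
      (flow_mult e nng0 a ∘ fmap (flow_functor e) (flow_unit a))
    = idm (flow_functor e a);
  flow_multA : forall (e z d : {nonneg R}) (a : C),
    reindex flow_functor a (nngDA e z d) ∘
      (flow_mult e (nngD z d) a ∘ fmap (flow_functor e) (flow_mult z d a))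
    = flow_mult (nngD e z) d a ∘ flow_mult e z (flow_functor d a);
  flow_le_mult : forall (e z d k : {nonneg R})
      (ed : nng_le e d) (zk : nng_le z k) (a : C),
    flow_mult d k a ∘
      (fmap (flow_functor d) ((fmap flow_functor zk : nat_trans _ _) a) ∘
       (fmap flow_functor ed : nat_trans _ _) (flow_functor z a))
    = (fmap flow_functor (nng_leD ed zk) : nat_trans _ _) a ∘ flow_mult e z a }.

Definition flow_le (R : realType) (C : category) (T : flow R C)
    (e z : {nonneg R}) (ez : nng_le e z) : nat_trans (T e) (T z) := fmap T ez.

Definition weak_interleaving (R : realType) (C : category) (T : flow R C)
    (e : {nonneg R}) (a b : C) (phi : hom a (T e b)) (psi : hom b (T e a)) :=
  flow_mult T e e a ∘ (fmap (T e) psi ∘ phi)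
    = flow_le T (nng_ge0 (nngD e e)) a ∘ flow_unit T a /\
  flow_mult T e e b ∘ (fmap (T e) phi ∘ psi)
    = flow_le T (nng_ge0 (nngD e e)) b ∘ flow_unit T b.

Definition weakly_interleaved (R : realType) (C : category) (T : flow R C)
    (e : {nonneg R}) (a b : C) : Prop :=
  exists (phi : hom a (T e b)) (psi : hom b (T e a)), weak_interleaving phi psi.

Definition interleaving_distance (R : realType) (C : category) (T : flow R C)
    (a b : C) : \bar R :=
  ereal_inf [set e%:num%:E | e in
    [set e : {nonneg R} | weakly_interleaved T e a b]].

Section hausdorff.
Variables (R : realType) (X : metricType R).

Definition thickening (e : R) (A : set X) : set X :=
  \bigcup_(a in A) [set x | mdist a x <= e].

Definition hausdorff_distance (A B : set X) : \bar R :=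
  ereal_inf [set e%:num%:E | e in
    [set e : {nonneg R} |
      A `<=` thickening e%:num B /\ B `<=` thickening e%:num A]].

Lemma thickeningS (e : R) (A B : set X) :
  A `<=` B -> thickening e A `<=` thickening e B.
Proof. by move=> AB x [a Aa ax]; exists a => //; exact: AB. Qed.

Lemma thickening_le (e z : R) (A : set X) :
  e <= z -> thickening e A `<=` thickening z A.
Proof. by move=> ez x [a Aa ax]; exists a => //=; exact: le_trans ax ez. Qed.

Lemma sub_thickening (e : R) (A : set X) : 0 <= e -> A `<=` thickening e A.
Proof. by move=> e0 x Ax; exists x => //=; rewrite mdistxx. Qed.

Lemma thickeningD (e z : R) (A : set X) :
  thickening e (thickening z A) `<=` thickening (e + z) A.
Proof.
move=> x [y [a Aa /= ay] /= yx]; exists a => //=.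
by rewrite (le_trans (metric_triangle a y x))// addrC lerD.
Qed.

Definition nonempty_set : Type := {A : set X | A !=set0}.

Definition nonempty_le (A B : nonempty_set) : Prop := sval A `<=` sval B.

Lemma nonempty_le_refl (A : nonempty_set) : nonempty_le A A. Proof. exact: subset_refl. Qed.

Lemma nonempty_le_trans (A B D : nonempty_set) :
  nonempty_le A B -> nonempty_le B D -> nonempty_le A D.
Proof. exact: subset_trans. Qed.

Definition nonempty_cat : category :=
  preorder_cat nonempty_le_refl nonempty_le_trans.

Lemma nonempty_hom_eq (A B : nonempty_cat) (f g : hom A B) : f = g.
Proof. exact: (@Prop_irrelevance (nonempty_le A B)). Qed.

Lemma nonempty_thickening (e : {nonneg R}) (A : nonempty_set) :
  thickening e%:num (sval A) !=set0.
Proof. by case: A => A [a Aa]; exists a; apply: sub_thickening. Qed.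

Definition omega_obj (e : {nonneg R}) (A : nonempty_cat) : nonempty_cat :=
  exist _ (thickening e%:num (sval A)) (nonempty_thickening e A).

Definition omega_endo (e : {nonneg R}) : functor nonempty_cat nonempty_cat :=
  @Functor nonempty_cat nonempty_cat (omega_obj e)
    (fun A B (AB : nonempty_le A B) => thickeningS (e := e%:num) AB)
    (fun _ => nonempty_hom_eq _ _) (fun _ _ _ _ _ => nonempty_hom_eq _ _).

Definition omega_le (e z : {nonneg R}) (ez : nng_le e z) :
    nat_trans (omega_endo e) (omega_endo z) :=
  @NatTrans _ _ (omega_endo e) (omega_endo z)
    (fun A => thickening_le (A := sval A) ez)
    (fun _ _ _ => nonempty_hom_eq _ _).

Definition omega_functor : functor (nonneg_cat R) (End_cat nonempty_cat) :=
  @Functor (nonneg_cat R) (End_cat nonempty_cat) omega_endo omega_le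
    (fun _ => nat_transP (fun _ => nonempty_hom_eq _ _))
    (fun _ _ _ _ _ => nat_transP (fun _ => nonempty_hom_eq _ _)).

Definition omega_unit : nat_trans (id_functor nonempty_cat) (omega_endo nng0) :=
  @NatTrans _ _ (id_functor nonempty_cat) (omega_endo nng0)
    (fun A => sub_thickening (A := sval A) (lexx 0))
    (fun _ _ _ => nonempty_hom_eq _ _).

Definition omega_mult (e z : {nonneg R}) :
    nat_trans (comp_functor (omega_endo e) (omega_endo z))
              (omega_endo (nngD e z)) :=
  @NatTrans _ _ (comp_functor (omega_endo e) (omega_endo z))
    (omega_endo (nngD e z))
    (fun A => thickeningD (e := e%:num) (z := z%:num) (A := sval A))
    (fun _ _ _ => nonempty_hom_eq _ _).

Definition Omega : flow R nonempty_cat :=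
  @Flow R nonempty_cat omega_functor omega_unit omega_mult
    (fun _ _ => nonempty_hom_eq _ _) (fun _ _ => nonempty_hom_eq _ _)
    (fun _ _ _ _ => nonempty_hom_eq _ _)
    (fun _ _ _ _ _ _ _ => nonempty_hom_eq _ _).

End hausdorff.

Arguments nonempty_set {R} X.
Arguments nonempty_cat {R} X.
Arguments Omega {R} X.

(* Main.v *)
Require Import Defs.
From mathcomp Require Import all_boot all_order all_algebra.
From mathcomp Require Import interval_inference.
From mathcomp Require Import boolp classical_sets reals constructive_ereal ereal.
From mathcomp Require Import topology.

(** Both distances are infima of sets of radii, and the two sets are equal.
    In the poset of nonempty subsets, a morphism [A -> B] is a proof that [A]
    is included in [B]; hence a pair of morphisms [A -> Omega_e B] and
    [B -> Omega_e A] is exactly a pair of inclusions [A <= B_e] and [B <= A_e].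
    The two interleaving equations compare parallel morphisms of a poset, so
    they always hold ([nonempty_hom_eq]). *)

Local Open Scope classical_set_scope.
Local Open Scope ring_scope.

Lemma weakly_interleaved_OmegaP (R : realType) (X : metricType R)
    (e : {nonneg R}) (A B : nonempty_set X) :
  weakly_interleaved (Omega X) e A B <->
  sval A `<=` thickening e%:num (sval B) /\
  sval B `<=` thickening e%:num (sval A).
Proof.
split=> [[phi [psi _]]|[AB BA]]; first by split; [exact: phi|exact: psi].
by exists AB, BA; split; exact: nonempty_hom_eq.
Qed.

Theorem theorem3p8 (R : realType) (X : metricType R) (A B : nonempty_set X) :
  interleaving_distance (Omega X) A B = hausdorff_distance (sval A) (sval B).
Proof.
rewrite /interleaving_distance /hausdorff_distance.
congr (ereal_inf (image _ _)).
by apply/funext => e; apply/propext; exact: weakly_interleaved_OmegaP.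
Qed.
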